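(* For all positive integers $s,t,n$, $$R_{<}(K_{s+1},P_n^t) \leq (24s^3)^{st}\, n.$$
   Context: An ordered graph is a graph whose vertices have a fixed linear ordering. For ordered graphs $G,H$, the ordered Ramsey number $R_{<}(G,H)$ is the minimum $N$ such that every red/blue edge-coloring of the complete graph on $\{1,\dots,N\}$ contains a red copy of $G$ or a blue copy of $H$ whose vertices appear in the correct order (i.e. the embedding into $\{1,\dots,N\}$ is order-preserving). $K_m$ is the complete (ordered) graph on $m$ vertices. $P_n^t$ is the $t$-th power of the monotone path on $n$ vertices: the ordered graph with vertices $1,\dots,n$ and edge set $\{(i,j) : i < j \leq i+t\}$. *)

(* Defs.v *)
From mathcomp Require Import all_boot.

Set Implicit Arguments.
Unset Strict Implicit.
Unset Printing Implicit Defensive.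

(* An ordered graph: the linear order on the vertex set 'I_nverts is that of
   the natural numbers. *)
Record ograph := OGraph {
  nverts : nat;
  adj : rel 'I_nverts;
  adj_sym : symmetric adj;
  adj_irr : irreflexive adj
}.

Fact complete_sym m : symmetric (fun i j : 'I_m => i != j).
Proof. by move=> i j; rewrite eq_sym. Qed.

Fact complete_irr m : irreflexive (fun i j : 'I_m => i != j).
Proof. by move=> i; rewrite eqxx. Qed.

Definition complete_ograph (m : nat) : ograph :=
  OGraph (@complete_sym m) (@complete_irr m).

(* Vertices are numbered from 0 instead of 1; the edge condition
   i < j <= i + t is invariant under this shift. *)
Definition power_path_adj (n t : nat) : rel 'I_n :=
  fun i j => (i < j <= i + t) || (j < i <= j + t).

Fact power_path_sym n t : symmetric (@power_path_adj n t).
Proof. by move=> i j; rewrite /power_path_adj orbC. Qed.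

Fact power_path_irr n t : irreflexive (@power_path_adj n t).
Proof. by move=> i; rewrite /power_path_adj ltnn. Qed.

Definition power_path (n t : nat) : ograph :=
  OGraph (@power_path_sym n t) (@power_path_irr n t).

(* The edges of the complete graph on N vertices are the two-element sets of
   vertices.  A coloring assigns a value to every set of vertices, but only
   its values on edges are ever used (see contains_copy); true is red and
   false is blue. *)
Definition coloring (N : nat) := {ffun {set 'I_N} -> bool}.

(* c contains a copy of G, all of whose edges have color b, with the vertices
   in the correct order (so that f is injective). *)
Definition contains_copy (N : nat) (c : coloring N) (b : bool) (G : ograph) :
    bool :=
  [exists f : {ffun 'I_(nverts G) -> 'I_N},
    [forall i : 'I_(nverts G), forall j : 'I_(nverts G),
       ((i < j) ==> (f i < f j)) && (adj i j ==> (c [set f i; f j] == b))]].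

Definition ramsey_arrow (G H : ograph) (N : nat) : bool :=
  [forall c : coloring N, contains_copy c true G || contains_copy c false H].

Definition mono_clique N (c : coloring N) (b : bool) (B : {set 'I_N}) :=
  forall i j, i \in B -> j \in B -> i != j -> c [set i; j] = b.

Lemma ramsey_cliques m n : exists K, forall N (c : coloring N) (A : {set 'I_N}),
  K <= #|A| -> exists B : {set 'I_N}, B \subset A /\
    ((#|B| = m /\ mono_clique c true B) \/ (#|B| = n /\ mono_clique c false B)).
Proof.
have cl0 N (c : coloring N) b : mono_clique c b set0.
  by move=> i j; rewrite in_set0.
have step N (c : coloring N) b (A B : {set 'I_N}) x :
    x \in A -> B \subset [set y in A :\ x | c [set x; y] == b] ->
    mono_clique c b B ->
    [/\ x |: B \subset A, #|x |: B| = #|B|.+1 & mono_clique c b (x |: B)].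
  move=> xA /subsetP sB cB; split.
  - apply/subsetP=> y /setU1P[->//|/sB].
    by rewrite !inE => /andP[/andP[_ ->]].
  - rewrite cardsU1; case: (boolP (x \in B)) => // /sB.
    by rewrite !inE eqxx.
  move=> i j /setU1P[->|iB] /setU1P[->|jB]; first by rewrite eqxx.
  - by move=> _; have:= sB j jB; rewrite !inE => /andP[_ /eqP].
  - by move=> _; have:= sB i iB; rewrite !inE setUC => /andP[_ /eqP].
  exact: cB.
elim: m n => [n|m IHm].
  by exists 0 => N c A _; exists set0; rewrite sub0set cards0; split=> //; left.
elim=> [|n [K2 IH2]].
  by exists 0 => N c A _; exists set0; rewrite sub0set cards0; split=> //; right.
have [K1 IH1] := IHm n.+1.
exists (K1 + K2).+1 => N c A leA.
have /card_gt0P[x xA]: 0 < #|A| by apply: leq_trans leA.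
pose nb b := [set y in A :\ x | c [set x; y] == b].
have sub_nb b : nb b \subset A.
  by apply/subsetP=> y; rewrite !inE => /andP[/andP[_ ->]].
have cardA : #|A :\ x| = #|nb true| + #|nb false|.
  rewrite -(cardsID [set y | c [set x; y] == true] (A :\ x)).
  congr (_ + _); apply: eq_card => y; rewrite !inE //.
  by case: (c _); rewrite ?andbT ?andbF.
have : K1 + K2 <= #|nb true| + #|nb false|.
  by rewrite -cardA -ltnS; move: leA; rewrite (cardsD1 x A) xA.
have [le1 _|lt1 le12] := leqP K1 #|nb true|.
  have [B [sB [[cB qB]|[cB qB]]]] := IH1 N c _ le1.
    have [s1 s2 s3] := step _ _ _ _ _ _ xA sB qB.
    by exists (x |: B); split=> //; left; rewrite s2 cB.
  by exists B; split; [exact: subset_trans sB (sub_nb _) | right].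
have le2 : K2 <= #|nb false|.
  rewrite leqNgt; apply/negP=> lt2; move: le12.
  by rewrite leqNgt -addnS leq_add // ltnW.
have [B [sB [[cB qB]|[cB qB]]]] := IH2 N c _ le2.
  by exists B; split; [exact: subset_trans sB (sub_nb _) | left].
have [s1 s2 s3] := step _ _ _ _ _ _ xA sB qB.
by exists (x |: B); split=> //; right; rewrite s2 cB.
Qed.

Lemma clique_contains_copy N (c : coloring N) b (B : {set 'I_N}) (G : ograph) :
  #|B| = nverts G -> mono_clique c b B -> contains_copy c b G.
Proof.
move=> cB qB.
pose f (i : 'I_(nverts G)) : 'I_N := enum_val (cast_ord (esym cB) i).
have homf (i j : 'I_(nverts G)) : i < j -> f i < f j.
  move=> ltij; have ltj : j < #|B| by rewrite cB.
  have lti : i < #|B| by rewrite cB.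
  have srt : sorted ltn (map val (enum B)).
    rewrite sorted_map; apply: sorted_filter.
      by move=> x y z; apply: ltn_trans.
    by rewrite -sorted_map -enumT val_enum_ord iota_ltn_sorted.
  rewrite /f /enum_val; set x0 := enum_default _.
  rewrite (set_nth_default x0 (enum_default _)) /= -?cardE //.
  rewrite -!(nth_map _ 0 val) -?cardE //.
  by apply: (sorted_ltn_nth ltn_trans) => //; rewrite inE size_map -cardE.
apply/existsP; exists (finfun f); apply/forallP=> i; apply/forallP=> j.
rewrite !ffunE; apply/andP; split; first by apply/implyP; apply: homf.
apply/implyP=> aij; apply/eqP; apply: qB; try exact: enum_valP.
apply/eqP=> /enum_val_inj /cast_ord_inj eij.
by move: aij; rewrite eij adj_irr.
Qed.

Lemma ramsey_arrow_ex G H : exists N, ramsey_arrow G H N.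
Proof.
have [K hK] := ramsey_cliques (nverts G) (nverts H).
exists K; apply/forallP=> c.
have [|B [_ [[cB qB]|[cB qB]]]] := hK K c [set: 'I_K].
- by rewrite cardsT card_ord.
- by rewrite (clique_contains_copy cB qB).
- by rewrite (clique_contains_copy cB qB) orbT.
Qed.

Definition ordered_ramsey (G H : ograph) : nat := ex_minn (ramsey_arrow_ex G H).

(* Main.v *)
Require Import Defs.
From mathcomp Require Import all_boot.
From mathcomp Require Import zify.

(* Suppose there is no red K_(s+1) and no blue power path on n vertices.  Cut
   the vertices into sn + 1 intervals; by Ramsey's theorem each one contains a
   large blue clique, which is cut into s + 1 consecutive parts of size d.  Let
   l a i be the largest length of a blue walk that can be continued into every
   part of clique i of index > a; it is nondecreasing in a and less than n.  A
   blue K_(t,t) between part b of clique i and part a of a later clique j, with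
   a < b, gives l (b-1) i < l a j: append its two sides to an optimal walk.
   Since there are more than sn cliques, a pigeonhole argument yields cliques
   j_s < ... < j_0 with l a j_a <= l a j_(a+1), which rules out such a K_(t,t)
   between part b of j_b and part a of j_a for all a < b.  By Kovari-Sos-Turan
   the blue graph between these s + 1 parts is then so sparse that they contain
   a red transversal, which is a red K_(s+1). *)

(** * Extremal tools: bicliques in dense bipartite graphs, and independent transversals *)

Lemma subset_of_card (T : finType) (A : {set T}) k :
  k <= #|A| -> exists2 B : {set T}, B \subset A & #|B| = k.
Proof.
move=> lek; exists [set x in take k (enum A)].
  by apply/subsetP=> x; rewrite inE => /mem_take; rewrite mem_enum.
rewrite cardsE (card_uniqP _) ?take_uniq ?enum_uniq // size_take -cardE.
by case: ltngtP lek.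
Qed.

Lemma card_bigcup_leq (I T : finType) (P : pred I) (F : I -> {set T}) k :
  (forall i, P i -> #|F i| <= k) -> #|\bigcup_(i | P i) F i| <= #|P| * k.
Proof.
move=> leF; rewrite -sum_nat_const.
elim/big_rec2: _ => [|i m A Pi leA]; first by rewrite cards0.
by rewrite (leq_trans (leq_card_setU _ _)) // leq_add ?leF.
Qed.

(* The Kovari-Sos-Turan argument, choosing the vertices of [W] greedily by
   degree. *)
Lemma dense_biclique (A B : finType) (e : A -> B -> bool) (K q t k : nat)
    (X : {set A}) (Y : {set B}) :
  0 < K -> 0 < q -> 0 < t -> #|Y| <= K * q ->
  (forall x, x \in X -> q + k <= #|[set y in Y | e x y]|) ->
  t * K ^ k <= #|X| ->
  exists (U : {set A}) (W : {set B}), [/\ U \subset X, W \subset Y, #|U| = t, #|W| = k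
    & forall x y, x \in U -> y \in W -> e x y].
Proof.
move=> K0 q0 t0; elim: k X Y => [|k IHk] X Y leY degX leX.
  have [U sU cU] := @subset_of_card _ X t ltac:(by rewrite muln1 in leX).
  by exists U, set0; rewrite sub0set cards0; split=> // x y; rewrite inE.
have X0 : 0 < #|X| by apply: leq_trans leX; rewrite muln_gt0 t0 expn_gt0 K0.
(* Averaging: at least [#|X| * q] edges meet at most [K * q] vertices of [Y], so some [u] is joined
   to at least a fraction [1 / K] of [X]. *)
have [u uY leu] : exists2 u, u \in Y & #|X| <= K * #|[set x in X | e x u]|.
  apply/exists_inP; apply: contraT => /exists_inPn small.
  have dc : \sum_(x in X) #|[set y in Y | e x y]|
      = \sum_(y in Y) #|[set x in X | e x y]|.
    under eq_bigr do rewrite cardsE -sum1_card big_mkcondr.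
    under [RHS]eq_bigr do rewrite cardsE -sum1_card big_mkcondr.
    exact: exchange_big.
  have lo : #|X| * q <= \sum_(x in X) #|[set y in Y | e x y]|.
    rewrite -sum_nat_const; apply: leq_sum => x xX.
    by apply: leq_trans (degX x xX); rewrite leq_addr.
  have hi : K * \sum_(y in Y) #|[set x in X | e x y]| <= #|Y| * #|X|.-1.
    rewrite -sum_nat_const big_distrr; apply: leq_sum => y yY.
    by rewrite -ltnS prednK // ltnNge small.
  have : K * (#|X| * q) <= K * q * #|X|.-1.
    apply: leq_trans (leq_mul leY (leqnn _)); apply: leq_trans hi.
    by rewrite -dc leq_pmul2l.
  by rewrite mulnCA mulnC leq_pmul2l ?muln_gt0 ?K0 // leqNgt ltn_predL X0.
(* Keeping only the neighbours of [u] and deleting [u] from [Y] lowers each degree by exactly one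
   and [#|X|] by a factor at most [K]. *)
have [|x||U [W [sU sW cU cW eUW]]] := IHk [set x in X | e x u] (Y :\ u).
- by apply: leq_trans leY; rewrite subset_leq_card ?subD1set.
- rewrite inE => /andP[xX exu].
  have := degX x xX; rewrite addnS (cardsD1 u) inE uY exu ltnS.
  by congr (_ <= _); apply: eq_card => y; rewrite !inE andbA.
- by rewrite -(leq_pmul2l K0); apply: leq_trans leu; rewrite mulnCA -expnS.
exists U, (u |: W); split=> //.
- by apply: subset_trans sU _; apply/subsetP=> x; rewrite inE => /andP[].
- apply/subsetP=> y /setU1P[->//|/(subsetP sW)].
  by rewrite inE => /andP[].
- rewrite cardsU1 cW; case: (boolP (u \in W)) => // /(subsetP sW).
  by rewrite !inE eqxx.
move=> x y xU /setU1P[->|]; last exact: eUW.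
by have := subsetP sU x xU; rewrite inE => /andP[].
Qed.

(** Greedy choice, where each chosen vertex has at most [Q] neighbours in every later set. In [E k]
    the neighbours of an earlier choice, or the vertices of large degree into a later set, are at
    most [Q]. These [s] exclusions cannot exhaust [E k]. *)
Lemma independent_transversal (T : finType) (e : rel T) (s Q : nat)
    (E : nat -> {set T}) :
  (forall a, a <= s -> s * Q < #|E a|) ->
  (forall a b, a < b <= s ->
     #|[set v in E a | Q < #|[set w in E b | e v w]|]| <= Q) ->
  exists f : nat -> T, (forall a, a <= s -> f a \in E a)
    /\ (forall a b, a < b <= s -> ~~ e (f a) (f b)).
Proof.
move=> bigE badE.
suff: forall k, k <= s.+1 -> exists f : nat -> T,
    [/\ forall a, a < k -> f a \in E a,
        forall a b, a < k -> a < b <= s -> #|[set w in E b | e (f a) w]| <= Q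
      & forall a b, a < b < k -> ~~ e (f a) (f b)].
  by case/(_ _ (leqnn _)) => f [fE _ ef]; exists f.
elim=> [|k IHk] ltk.
  have /card_gt0P[x _] : 0 < #|E 0| by apply: leq_ltn_trans (bigE 0 _).
  by exists (fun=> x); split=> // a b; rewrite ltn0 andbF.
have {IHk}[f [fE fdeg ef]] := IHk (ltnW ltk).
pose F (b : 'I_s.+1) := if b < k then [set w in E k | e (f b) w]
  else [set v in E k | Q < #|[set w in E b | e v w]|].
have [v vE vF] : exists2 v, v \in E k & v \notin \bigcup_(b | b != Ordinal ltk) F b.
  apply/subsetPn; apply/negP=> /subset_leq_card; rewrite leqNgt => /negP; apply.
  apply: leq_ltn_trans (bigE k ltk).
  have cards : #|predC1 (Ordinal ltk)| = s by rewrite cardC1 card_ord.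
  have : #|\bigcup_(b | b != Ordinal ltk) F b| <= #|predC1 (Ordinal ltk)| * Q.
    apply: card_bigcup_leq => b neb; rewrite /F.
    case: ltnP => [ltb|leb]; first by rewrite fdeg // ltb.
    by apply: badE; rewrite -(ltnS b) ltn_ord andbT ltn_neqAle leb eq_sym andbT.
  by rewrite cards.
have vF' (b : 'I_s.+1) : b != k :> nat -> v \notin F b.
  by move=> neb; apply: contra vF => vFb; apply/bigcupP; exists b.
exists (fun a => if a == k then v else f a); split=> [a|a b|a b].
- by rewrite ltnS; case: eqVneq => [->|ne lea] //; apply: fE; rewrite ltn_neqAle ne.
- rewrite ltnS => lea /andP[ltab leb]; case: eqVneq lea => [eak _|ne lea].
    have := vF' (Ordinal (leb : b < s.+1)); rewrite /F /= -eak ltnNge ltnW //=.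
    rewrite !inE eak vE /= -leqNgt; apply.
    by rewrite -eak neq_ltn ltab orbT.
  by apply: fdeg; rewrite ?ltab // ltn_neqAle ne.
case/andP=> ltab; rewrite ltnS => leb.
have ltak := leq_trans ltab leb; rewrite (ltn_eqF ltak).
case: eqVneq leb => [_ _|ne leb].
  have := vF' (Ordinal (ltn_trans ltak ltk)); rewrite /F /= ltak inE vE.
  by apply; rewrite neq_ltn ltak.
by apply: ef; rewrite ltab ltn_neqAle ne.
Qed.

(** * Consecutive blocks of an ordered vertex set *)

Section Slices.

Context {N : nat}.
Implicit Types A B : {set 'I_N}.

Lemma enum_ord_sorted B : sorted ltn (map val (enum B)).
Proof.
rewrite sorted_map; apply: sorted_filter; first by move=> x y z; apply: ltn_trans.
by rewrite -sorted_map -enumT val_enum_ord iota_ltn_sorted.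
Qed.

(** Serves both to cut the vertex set into intervals and to cut a blue clique into parts. *)
Definition slice B d a : {set 'I_N} := [set x in take d (drop (a * d) (enum B))].

Lemma slice_sub B d a : slice B d a \subset B.
Proof.
by apply/subsetP=> x; rewrite inE => /mem_take/mem_drop; rewrite mem_enum.
Qed.

Lemma card_slice B d k a : #|B| = k * d -> a < k -> #|slice B d a| = d.
Proof.
move=> cB ltak.
rewrite cardsE (card_uniqP _) ?take_uniq ?drop_uniq ?enum_uniq //.
rewrite size_takel // size_drop -cardE cB -mulnBl -{1}[d]mul1n leq_mul2r.
by rewrite subn_gt0 ltak orbT.
Qed.

Lemma slice_lt B d a b (x y : 'I_N) :
  a < b -> x \in slice B d a -> y \in slice B d b -> x < y.
Proof.
rewrite !inE => ltab xa yb.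
have := enum_ord_sorted B; rewrite sorted_map sorted_pairwise; last first.
  by move=> ? ? ?; apply: ltn_trans.
rewrite -(cat_take_drop (a.+1 * d) (enum B)) pairwise_cat.
case/andP=> /allrelP lt _; apply: lt.
  by move: xa; rewrite take_drop -mulSn => /mem_drop.
move/mem_take: yb; rewrite -(subnK ltab) mulnDl -drop_drop.
exact: mem_drop.
Qed.

End Slices.

(** * Ramsey's theorem for cliques with an explicit bound *)

(** The usual neighbourhood recursion; the bound [m ^ s] is preserved because
    [m ^ s.+1 + m.+1 ^ s <= m.+1 ^ s.+1]. *)
Lemma clique_of_card N (c : coloring N) s m (A : {set 'I_N}) : m ^ s <= #|A| ->
  exists B : {set 'I_N}, B \subset A /\
    ((#|B| = s.+1 /\ mono_clique c true B) \/ (#|B| = m /\ mono_clique c false B)).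
Proof.
have step b (C B : {set 'I_N}) x :
    x \in C -> B \subset [set y in C :\ x | c [set x; y] == b] ->
    mono_clique c b B ->
    [/\ x |: B \subset C, #|x |: B| = #|B|.+1 & mono_clique c b (x |: B)].
  move=> xC /subsetP sB cB; split.
  - apply/subsetP=> y /setU1P[->//|/sB].
    by rewrite !inE => /andP[/andP[_ ->]].
  - rewrite cardsU1; case: (boolP (x \in B)) => // /sB.
    by rewrite !inE eqxx.
  move=> i j /setU1P[->|iB] /setU1P[->|jB]; first by rewrite eqxx.
  - by move=> _; have:= sB j jB; rewrite !inE => /andP[_ /eqP].
  - by move=> _; have:= sB i iB; rewrite !inE setUC => /andP[_ /eqP].
  exact: cB.
elim: s m A => [|s IHs] m A.
  rewrite expn0 => /card_gt0P[x xA]; exists [set x]; rewrite sub1set xA.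
  split=> //; left; rewrite cards1; split=> // i j /set1P-> /set1P->.
  by rewrite eqxx.
elim: m A => [|m IHm] A leA.
  exists set0; rewrite sub0set cards0; split=> //; right; split=> // i j.
  by rewrite inE.
have /card_gt0P[x xA] : 0 < #|A| by apply: leq_trans leA; rewrite expn_gt0.
pose nb b := [set y in A :\ x | c [set x; y] == b].
have sub_nb b : nb b \subset A.
  by apply/subsetP=> y; rewrite !inE => /andP[/andP[_ ->]].
have cardA : #|A| = (#|nb true| + #|nb false|).+1.
  rewrite (cardsD1 x) xA -(cardsID [set y | c [set x; y] == true] (A :\ x)).
  congr (_.+1); congr (_ + _); apply: eq_card => y; rewrite !inE //.
  by case: (c _); rewrite ?andbT ?andbF.
have [le1|lt1] := leqP (m.+1 ^ s) #|nb true|.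
  have [B [sB [[cB qB]|[cB qB]]]] := IHs _ _ le1.
    have [s1 s2 s3] := step _ _ _ _ xA sB qB.
    by exists (x |: B); split=> //; left; rewrite s2 cB.
  by exists B; split; [exact: subset_trans sB (sub_nb _) | right].
have le2 : m ^ s.+1 <= #|nb false|.
  have : m ^ s.+1 + m.+1 ^ s <= m.+1 ^ s.+1.
    rewrite (expnS m.+1) mulSn addnC leq_add2l expnS leq_mul2l.
    by case: (s) => [|k]; rewrite ?expn0 ?leq_exp2r ?leqnSn ?orbT.
  lia.
have [B [sB [[cB qB]|[cB qB]]]] := IHm _ le2.
  by exists B; split; [exact: subset_trans sB (sub_nb _) | left].
have [s1 s2 s3] := step _ _ _ _ xA sB qB.
by exists (x |: B); split=> //; right; rewrite s2 cB.
Qed.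

(** * Powers of monotone paths as sequences *)

Section PowerWalks.

Context {T : eqType} (e : rel T) (t : nat).

Fixpoint power_walk (p : seq T) : bool :=
  if p is x :: q then all (e x) (take t q) && power_walk q else true.

(** A pair at distance at most [t] across the junction starts among the last [t] entries of [p], and
    these are related to all of [q]. *)
Lemma power_walk_cat p q :
  power_walk p -> power_walk q -> allrel e (drop (size p - t) p) q ->
  power_walk (p ++ q).
Proof.
move=> + wq; elim: p => //= x p IHp /andP[ex wp] epq.
have [lep|ltp] := leqP t (size p).
  rewrite takel_cat // ex IHp //; by rewrite subSn in epq.
move: epq; have /eqP-> : (size p).+1 - t == 0 by rewrite subn_eq0.
rewrite drop0 allrel_consl => /andP[exq epq].
rewrite IHp //; last by have /eqP-> : size p - t == 0; rewrite ?drop0 // subn_eq0 ltnW.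
rewrite andbT take_cat ltnNge ltnW //= all_cat -{1}(take_oversize (ltnW ltp)) ex /=.
by apply/allP=> y /mem_take; apply/allP.
Qed.

Lemma power_walk_nth x0 p i j :
  power_walk p -> i < j <= i + t -> j < size p -> e (nth x0 p i) (nth x0 p j).
Proof.
elim: p i j => //= x p IHp [|i] [|j] //= /andP[ex wp] ij ltj.
  rewrite -(nth_take x0 (ij : j < t)); apply: (allP ex); apply: mem_nth.
  by rewrite size_take; case: ifP.
exact: IHp.
Qed.

Lemma power_walk_pairwise p : pairwise e p -> power_walk p.
Proof.
elim: p => //= x p IHp /andP[ex /IHp->]; rewrite andbT.
by apply/allP=> y /mem_take; apply/allP.
Qed.

End PowerWalks.

(** With [x < y] built in, a power walk for [0 < t] is increasing, so it embeds in the correct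
    order. *)
Definition blue {N} (c : coloring N) : rel 'I_N :=
  fun x y => (x < y) && (c [set x; y] == false).

Lemma power_walk_copy N (c : coloring N) t n (p : seq 'I_N) :
  0 < t -> 0 < n -> n <= size p -> power_walk (blue c) t p ->
  contains_copy c false (power_path n t).
Proof.
move=> t0 n0 len wp.
have [x0 _] : exists x0, x0 \in p by case: p len {wp} => [|x p]; [case: n n0|exists x; rewrite mem_head].
have lt_nth i j : i < j -> j < size p -> nth x0 p i < nth x0 p j.
  move=> ltij ltj.
  have srt : sorted (relpre val ltn) p.
    apply/(sortedP x0) => k ltk.
    have lek : k < k.+1 <= k + t by rewrite ltnSn -addn1 leq_add2l.
    by have /andP[] := power_walk_nth _ _ x0 p k k.+1 wp lek ltk.
  by apply: (sorted_ltn_nth _ _ srt) => //; [move=> ? ? ?; apply: ltn_trans|apply: ltn_trans ltj].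
apply/existsP; exists [ffun i : 'I_n => nth x0 p i].
apply/forallP=> i; apply/forallP=> j; rewrite !ffunE.
have lts (k : 'I_n) : k < size p by apply: leq_trans len.
apply/andP; split; first by apply/implyP=> ij; apply: lt_nth.
apply/implyP=> /orP[] ij; have := power_walk_nth _ _ x0 p _ _ wp ij (lts _).
  by case/andP.
by rewrite setUC => /andP[].
Qed.

Lemma power_walk_enum N (c : coloring N) t (U B : {set 'I_N}) :
  U \subset B -> mono_clique c false B -> power_walk (blue c) t (enum U).
Proof.
move=> sU cB; apply: power_walk_pairwise.
have := enum_ord_sorted U; rewrite sorted_map sorted_pairwise; last first.
  by move=> ? ? ?; apply: ltn_trans.
apply: (sub_in_pairwise (P := mem U)) => [x y xU yU ltxy|]; last first.
  by apply/allP=> x; rewrite mem_enum.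
rewrite /blue; apply/andP; split=> //; apply/eqP; apply: cB.
- exact: (subsetP sU).
- exact: (subsetP sU).
by apply: contraTneq ltxy => ->; rewrite /= ltnn.
Qed.

(** * The pigeonhole argument and the upper bound *)

(* Each step discards only those indices after which [l k] strictly
   increases, hence at most [n] of them. *)
Lemma descending_chain (M n s : nat) (l : nat -> 'I_M -> nat) :
  (forall a i, l a i < n) -> s * n < M ->
  exists j : nat -> 'I_M,
    forall a, a < s -> j a.+1 < j a /\ l a (j a) <= l a (j a.+1).
Proof.
move=> ln ltM.
(* Strengthened for induction: all but at most [s * n] indices are the last term [j s] of such a
   chain. *)
suff [S cS chS] : exists2 S : {set 'I_M}, M <= #|S| + s * n
    & forall i, i \in S -> exists2 j : nat -> 'I_M, j s = i
      & forall a, a < s -> j a.+1 < j a /\ l a (j a) <= l a (j a.+1).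
  have /card_gt0P[i /chS[j _ jP]] : 0 < #|S| by lia.
  by exists j.
elim: s {ltM} => [|s [S cS chS]].
  exists setT; rewrite ?cardsT ?card_ord ?addn0 // => i _.
  by exists (fun=> i).
pose S' := [set i in S | [exists i' in S, (i < i') && (l s i' <= l s i)]].
exists S'; last first.
  move=> i; rewrite inE => /andP[_ /exists_inP[i' /chS[j <- jP] /andP[lti lei]]].
  exists (fun a => if a == s.+1 then i else j a) => [|a]; first by rewrite eqxx.
  rewrite ltnS eqSS => lea; rewrite [a == s.+1]ltn_eqF ?ltnS //.
  by case: eqVneq lea => [->//|ne lea]; apply: jP; rewrite ltn_neqAle ne.
have : #|S :\: S'| <= n.
  rewrite -[X in _ <= X]card_ord -(card_in_imset (f := fun i => Ordinal (ln s i))).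
    exact: max_card.
  move=> i i' iS i'S [] eql; apply/eqP/negP=> /negP ne.
  wlog lti : i i' iS i'S eql ne / i < i'.
    move=> wlg; case: (ltngtP i i') => [lt|gt|/val_inj eq]; first exact: (wlg i i').
      by apply: (wlg i' i); rewrite // eq_sym.
    by rewrite eq eqxx in ne.
  move: iS i'S; rewrite !inE => /andP[+ iS] /andP[_ i'S]; rewrite iS.
  by move/exists_inP; apply; exists i'; rewrite // lti eql leqnn.
have : #|S'| + #|S :\: S'| = #|S|.
  by rewrite -(cardsID S' S) (setIidPr _) //; apply/subsetP=> i; rewrite inE => /andP[].
rewrite mulSn; lia.
Qed.

Lemma ramsey_arrow_power_path s t n : 0 < s -> 0 < t -> 0 < n ->
  ramsey_arrow (complete_ograph s.+1) (power_path n t)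
    ((s * n).+1 * (s.+1 * (2 * s * (t * (2 * s) ^ t))) ^ s).
Proof.
(* [q] is the size [t * K ^ t] that [dense_biclique] requires for [K = 2 * s] and [k = t], and parts
   have size [d = K * q]. An interval of [P] vertices yields a clique of [s.+1] parts. *)
move=> s0 t0 n0; set q := t * (2 * s) ^ t; set d := 2 * s * q.
set P := (s.+1 * d) ^ s; set N := _ * P; set M := (s * n).+1 in N *.
apply/forallP=> c; apply/orP; case: (boolP (contains_copy c true _)) => [|nored].
  by left.
right; apply: contraT => noblue.
have q0 : 0 < q by rewrite muln_gt0 t0 expn_gt0 muln_gt0 s0.
(* This gives [s * (q + t) < d], the size condition for the transversal. *)
have ltq : t < q.
  have : 2 * s <= (2 * s) ^ t by rewrite -{1}(expn1 (2 * s)) leq_pexp2l ?muln_gt0.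
  rewrite /q; nia.
have /fin_all_exists[B BP] (i : 'I_M) : exists B : {set 'I_N},
    [/\ B \subset slice [set: 'I_N] P i, #|B| = s.+1 * d & mono_clique c false B].
  have [|B [sB [[cB qB]|[cB qB]]]] := @clique_of_card _ c s (s.+1 * d) (slice [set: 'I_N] P i).
  - by rewrite (card_slice _ _ M) ?cardsT ?card_ord.
  - by rewrite (clique_contains_copy (G := complete_ograph s.+1) cB qB) in nored.
  by exists B.
pose D (i : 'I_M) a := slice (B i) d a.
have DB i a : D i a \subset B i by apply: slice_sub.
have cD i a : a <= s -> #|D i a| = d.
  by move=> les; apply: (card_slice _ _ s.+1) => //; case: (BP i).
have blueD i a b x y : a < b -> x \in D i a -> y \in D i b -> blue c x y.
  move=> ltab xa yb; have ltxy : x < y by apply: slice_lt ltab xa yb.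
  rewrite /blue ltxy; apply/eqP; have [_ _ cB] := BP i; apply: cB.
  - exact: (subsetP (DB i a)).
  - exact: (subsetP (DB i b)).
  by apply: contraTneq ltxy => ->; rewrite ltnn.
have ltD (i j : 'I_M) a b x y : i < j -> x \in D i a -> y \in D j b -> x < y.
  move=> ltij /(subsetP (DB _ _)) xB /(subsetP (DB _ _)) yB.
  have [/subsetP si _ _] := BP i; have [/subsetP sj _ _] := BP j.
  exact: slice_lt ltij (si _ xB) (sj _ yB).
(* As a walk in [blue c] is increasing, only its last [t] vertices matter for
   its continuations. *)
pose reach a i m := [exists p : m.-tuple 'I_N, power_walk (blue c) t p
  && [forall b : 'I_s.+1, (a < b) ==>
     [forall u in D i b, all (blue c ^~ u) (drop (m - t) p)]]].
have reach_lt a i m : reach a i m -> m < n.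
  case/existsP=> p /andP[wp _]; rewrite ltnNge; apply: contra noblue => lenm.
  by apply: (@power_walk_copy _ c t n p) => //; rewrite size_tuple.
have reach0 a i : reach a i 0.
  apply/existsP; exists [tuple]; apply/forallP=> b; apply/implyP=> _.
  by apply/forall_inP.
pose l a i := \max_(m < n | reach a i m) m.
have l_lt a i : l a i < n by rewrite -(prednK n0) ltnS; apply/bigmax_leqP=> m _; rewrite -ltnS prednK.
have le_l a i m : reach a i m -> m <= l a i.
  by move=> rm; apply: (leq_bigmax_cond (Ordinal (reach_lt _ _ _ rm))).
have reach_l a i : reach a i (l a i).
  have [|m rm lE] := @eq_bigmax_cond _ [pred m : 'I_n | reach a i m] val.
    by apply/card_gt0P; exists (Ordinal n0); apply: reach0.
  by have -> : l a i = m by rewrite -lE.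
(* A larger index leaves fewer parts to be joined to. *)
have l_mono a b i : a <= b -> l a i <= l b i.
  move=> leab; apply: le_l; have /existsP[p /andP[wp /forallP rp]] := reach_l a i.
  apply/existsP; exists p; rewrite wp; apply/forallP=> b'; apply/implyP=> ltb.
  by apply: (implyP (rp b')); apply: leq_ltn_trans ltb.
(* An optimal walk continues into [U] because [a < b], then into [W] by the biclique. Its last [t]
   vertices are now [W], inside part [a'] of the blue clique [j], hence joined to all later
   parts. *)
have reach_jump a a' b i j (U W : {set 'I_N}) : a < b <= s ->
    U \subset D i b -> W \subset D j a' -> #|U| = t -> #|W| = t ->
    (forall u w, u \in U -> w \in W -> blue c u w) -> l a i < l a' j.
  move=> /andP[ltab leb] sU sW cU cW bUW.
  have /existsP[p /andP[wp /forallP rp]] := reach_l a i.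
  have szU : size (enum U) = t by rewrite -cardE.
  have szW : size (enum W) = t by rewrite -cardE.
  have sz : size ((p ++ enum U) ++ enum W) == l a i + t + t.
    by rewrite !size_cat size_tuple szU szW.
  suff /le_l : reach a' j (l a i + t + t) by lia.
  apply/existsP; exists (Tuple sz); apply/andP; split=> /=.
    apply: power_walk_cat.
    - apply: power_walk_cat => //.
        by apply: (power_walk_enum _ _ _ _ (B i)); [apply: subset_trans sU _|case: (BP i)].
      apply/allrelP=> x u xp; rewrite mem_enum => /(subsetP sU) uD.
      have /forall_inP/(_ u uD)/allP := implyP (rp (Ordinal (leb : b < s.+1))) ltab.
      by apply; rewrite size_tuple in xp.
    - by apply: (power_walk_enum _ _ _ _ (B j)); [apply: subset_trans sW _|case: (BP j)].
    rewrite size_cat szU addnK drop_size_cat //.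
    by apply/allrelP=> u w; rewrite !mem_enum; apply: bUW.
  apply/forallP=> b'; apply/implyP=> ltb; apply/forall_inP=> u uD.
  rewrite addnK drop_size_cat; last by rewrite size_cat size_tuple szU.
  by apply/allP=> w; rewrite mem_enum => /(subsetP sW) wD; apply: blueD ltb wD uD.
have [j jP] : exists j : nat -> 'I_M,
    forall a, a < s -> j a.+1 < j a /\ l a (j a) <= l a (j a.+1).
  by apply: (descending_chain M n).
(* Alternating the chain inequality with [l_mono] climbs from [a] to the last usable index
   [b.-1]. *)
have jPP a b : a < b <= s -> j b < j a /\ l a (j a) <= l b.-1 (j b).
  case/andP; elim: b => // b IHb; rewrite ltnS leq_eqVlt.
  case/predU1P=> [<-|ltab] ltbs; first exact: jP.
  have [j1 l1] := jP b ltbs; have [j2 l2] := IHb ltab (ltnW ltbs).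
  split; first exact: ltn_trans j1 j2.
  by apply: leq_trans l1; apply: leq_trans l2 _; apply: l_mono; apply: leq_pred.
(* The relation is reversed because [j] decreases: for [a < b] the set of index [b] precedes that of
   index [a]. *)
have [||f [fE ef]] := @independent_transversal _
    (fun x y => blue c y x) s (q + t) (fun a => D (j a) a).
- by move=> a les; rewrite cD // /d; nia.
(* Too many vertices of large blue degree would produce a blue biclique, and [reach_jump] would
   contradict [jPP]. *)
- move=> a b ltab; rewrite leqNgt; apply/negP=> bigX.
  have /andP[lt_ab leb] := ltab; have [jba lba] := jPP a b ltab.
  have [||||||U [W [sU sW cU cW bUW]]] := @dense_biclique _ _ (fun x y => blue c y x)
    (2 * s) q t t [set v in D (j a) a | q + t < #|[set w in D (j b) b | blue c w v]|] (D (j b) b);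
    rewrite ?q0 ?cD ?muln_gt0 ?s0 //.
  + by move=> x; rewrite inE => /andP[_ /ltnW].
  + by rewrite -/q; apply: leq_trans (ltnW bigX); apply: leq_addr.
  have : l b.-1 (j b) < l a (j a).
    apply: (reach_jump b.-1 a b (j b) (j a) W U) => //.
    - by rewrite leb andbT; case: (b) lt_ab.
    - by apply: subset_trans sU _; apply/subsetP=> x; rewrite inE => /andP[].
    by move=> u w uW wU; apply: bUW.
  by rewrite ltnNge lba.
have ltf a b : a < b <= s -> f b < f a.
  move=> ltab; have /andP[lt_ab leb] := ltab; have [jba _] := jPP a b ltab.
  exact: ltD jba (fE b leb) (fE a (leq_trans (ltnW lt_ab) leb)).
have red a b : a < b <= s -> c [set f b; f a] = true.
  by move=> ltab; have := ef a b ltab; rewrite /blue ltf //=; case: (c _).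
case/negP: nored.
apply: (@clique_contains_copy _ c true [set f a | a : 'I_s.+1]
  (complete_ograph s.+1)).
  rewrite card_imset ?card_ord // => a b eqf; apply: val_inj.
  case: (ltngtP a b) => // lt.
    by have := ltf a b; rewrite lt eqf ltnn -ltnS ltn_ord => /(_ isT).
  by have := ltf b a; rewrite lt eqf ltnn -ltnS ltn_ord => /(_ isT).
move=> x y /imsetP[a _ ->] /imsetP[b _ ->] ne.
case: (ltngtP a b) => [lt|lt|/val_inj eq].
- by rewrite setUC; apply: red; rewrite lt -ltnS ltn_ord.
- by apply: red; rewrite lt -ltnS ltn_ord.
by rewrite eq eqxx in ne.
Qed.

Theorem theorem1p1 (s t n : nat) (hs : 0 < s) (ht : 0 < t) (hn : 0 < n) :
  ordered_ramsey (complete_ograph s.+1) (power_path n t)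
    <= (24 * s ^ 3) ^ (s * t) * n.
Proof.
rewrite /ordered_ramsey; case: ex_minnP => m _ minm.
apply: leq_trans (minm _ (ramsey_arrow_power_path s t n hs ht hn)) _.
set d := 2 * s * _.
(* Since [s * n + 1 <= 2 ^ s * n], the factor [2 ^ s] goes inside the [s]-th power, leaving this
   bound on the base. *)
have le_d : 2 * (s.+1 * d) <= (24 * s ^ 3) ^ t.
  (* The power [(2 * s) ^ t] in [d] splits off; what remains is [4 * s * (s + 1) * t <= 12 * s ^ 2 *
     t <= (12 * s ^ 2) ^ t]. *)
  have -> : 24 * s ^ 3 = 12 * s ^ 2 * (2 * s) by rewrite !expnS; lia.
  rewrite expnMn /d.
  have le1 : t * (12 * s ^ 2) <= (12 * s ^ 2) ^ t.
    have z1 : 1 < 12 * s ^ 2 by rewrite expnS expn1; nia.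
    case: (t) ht => // k _; rewrite (expnS _ k) mulnC leq_mul2l.
    by rewrite (ltn_expl k z1) orbT.
  apply: leq_trans (leq_mul le1 (leqnn _)).
  rewrite !mulnA leq_mul2r; apply/orP; right.
  by have := leq_mul hs (leqnn (s * t)); nia.
have le_n : (s * n).+1 <= 2 ^ s * n.
  have : s < 2 ^ s by apply: ltn_expl.
  nia.
apply: leq_trans (leq_mul le_n (leqnn _)) _.
rewrite mulnAC leq_mul2r -expnMn [s * t]mulnC expnM.
by rewrite leq_exp2r // le_d orbT.
Qed.
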